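(* Let $\mathbf{G}$ be an abelian group and let $A\subseteq\mathbf{G}$ be a finite set with $\mathsf{E}(A)=|A|^3/K$ and $\mathsf{E}_3(A)=M|A|^4/K^2$. Then there is a set $A'\subseteq A$ such that $$|A'|\gg M^{-10}\log^{-15} M\cdot |A|$$ and $$|nA'-mA'|\ll \left(M^{9}\log^{14} M\right)^{6(n+m)}K\,|A'|$$ for every $n,m\in\mathbb{N}$.
   Context: For a finite set $A\subseteq\mathbf{G}$ put $(A\circ A)(x)=|\{(a,b)\in A\times A: b-a=x\}|=|A\cap(A-x)|$. Then $\mathsf{E}(A)=\sum_x (A\circ A)(x)^2$ is the additive energy and $\mathsf{E}_3(A)=\sum_x (A\circ A)(x)^3$. $nA'-mA'$ denotes the set of all $a_1+\dots+a_n-b_1-\dots-b_m$ with $a_i,b_j\in A'$. Logarithms are to base $2$, and $\log^{k} M$ means $(\log M)^{k}$. The symbols $\ll$ and $\gg$ are the usual Vinogradov symbols; dependence of an implied constant on a parameter would be indicated by a subscript.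
   Formalization: In both bounds M is replaced by max(M,2), and A is assumed nonempty; as written the claim is undefined at M=1 and false as M→1+ (e.g. A a large finite subgroup minus a point, where log^{-15} M is unbounded), while for M≥2 it is unchanged. *)

(* Defs.v *)
From HB Require Import structures.
From mathcomp Require Import all_boot all_order all_algebra.
From mathcomp Require Import finmap.
From mathcomp Require Import reals exp.

Set Implicit Arguments.
Unset Strict Implicit.
Unset Printing Implicit Defensive.

Import GRing.Theory.

Local Open Scope ring_scope.
Local Open Scope fset_scope.

(* (A o A)(x) *)
Definition corr (G : zmodType) (A : {fset G}) (x : G) : nat :=
  #|` [fset p in A `*` A | p.2 - p.1 == x] |.

Definition diffset (G : zmodType) (A : {fset G}) : {fset G} :=
  [fset b - a | a in A, b in A].

(* G may be infinite; the sums over x in G defining the energies below range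
   over A - A, which is licit because corr A vanishes elsewhere. *)
Lemma corr_eq0 (G : zmodType) (A : {fset G}) (x : G) :
  x \notin diffset A -> corr A x = 0%N.
Proof.
move=> xA; apply/eqP; rewrite cardfs_eq0; apply/eqP/fsetP => -[a b].
rewrite !inE /=; apply/negP => /andP[/andP[aA bA] /eqP abx].
by move/negP: xA; apply; rewrite -abx; apply/imfset2P; exists a => //; exists b.
Qed.

Definition energy (G : zmodType) (A : {fset G}) : nat :=
  (\sum_(x <- diffset A) corr A x ^ 2)%N.

Definition energy3 (G : zmodType) (A : {fset G}) : nat :=
  (\sum_(x <- diffset A) corr A x ^ 3)%N.

(* nA - mA: the functions a and b list the (not necessarily distinct) summands.
   In particular 0A - 0A = {0}. *)
Definition sumdiff (G : zmodType) (n m : nat) (A : {fset G}) : {fset G} :=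
  [fset \sum_(i < n) val (a i) - \sum_(j < m) val (b j)
     | a : {ffun 'I_n -> A} in {: {ffun 'I_n -> A}},
       b : {ffun 'I_m -> A} in {: {ffun 'I_m -> A}}].

Definition log2 (R : realType) (x : R) : R := ln x / ln 2.

(* Main.v *)
Require Import Defs.
From HB Require Import structures.
From mathcomp Require Import all_boot all_order all_algebra.
From mathcomp Require Import finmap.
From mathcomp Require Import reals exp.
From mathcomp Require Import ring lra.

(** Write N = |A|, f = corr A.  The differences x with f(x) of order N/K, up to
    factors of M, form a set P with |P| << K N that carries at least half of the
    energy.  Two applications of Cauchy-Schwarz give about N^6/K^3 for the
    number of triples a, b, c of A weighted by f(a-b) f(c-b) f(c-a) with a-b and
    c-b popular.  A third one, against |A n (A-x) n (A-y)|, whose second moment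
    is E_3(A), bounds below the sum over x, y in P of f(x)^2 f(y)^2 f(x-y)^2 by
    N^8/(K^4 M) up to a constant: only one power of M is lost, because
    f^2 is kept as a weight instead of passing to cardinalities.  A weighted
    Balog-Szemeredi-Gowers argument turns this into a set X of popular
    differences with |X - X| << M^30 |X| and with a translate of X meeting A in
    A', |A'| >> M^-7 N.  Plunnecke's inequality for X concludes when M is large.
    When M is bounded, the implied constant of the doubling of X cannot be raised
    to the power n+m, and Ruzsa's covering lemma is used instead: it makes
    |nX - mX| grow polynomially in n and m. *)

Set Implicit Arguments.
Unset Strict Implicit.
Unset Printing Implicit Defensive.

Import Order.TTheory GRing.Theory Num.Theory.

Local Open Scope fset_scope.
Local Open Scope ring_scope.

(** * Sumsets and Plunnecke's inequality *)

Section Sumsets.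
Variable G : zmodType.
Implicit Types A B C X Y Z S : {fset G}.

Definition sumset A B : {fset G} := [fset (a + b)%R | a in A, b in B].

Definition diffset2 A B : {fset G} := [fset (a - b)%R | a in A, b in B].

Definition shift (c : G) A : {fset G} := [fset (c + a)%R | a in A].

Definition nsum (n : nat) A : {fset G} := iter n (sumset A) [fset 0%R].

Lemma sumsetP A B x :
  reflect (exists a b, [/\ a \in A, b \in B & x = (a + b)%R]) (x \in sumset A B).
Proof.
apply: (iffP (imfset2P _ _ _ _ _)) => [[a aA [b bB ->]]|[a [b [aA bB ->]]]].
  by exists a, b.
by exists a => //; exists b.
Qed.

Lemma diffset2P A B x :
  reflect (exists a b, [/\ a \in A, b \in B & x = (a - b)%R]) (x \in diffset2 A B).
Proof.
apply: (iffP (imfset2P _ _ _ _ _)) => [[a aA [b bB ->]]|[a [b [aA bB ->]]]].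
  by exists a, b.
by exists a => //; exists b.
Qed.

Lemma mem_sumset A B a b : a \in A -> b \in B -> (a + b)%R \in sumset A B.
Proof. by move=> aA bB; apply/sumsetP; exists a, b. Qed.

Lemma mem_diffset2 A B a b : a \in A -> b \in B -> (a - b)%R \in diffset2 A B.
Proof. by move=> aA bB; apply/diffset2P; exists a, b. Qed.

Lemma shiftP c A x : reflect (exists2 a, a \in A & x = (c + a)%R) (x \in shift c A).
Proof. exact: imfsetP. Qed.

Lemma mem_shift c A x : (x \in shift c A) = ((x - c)%R \in A).
Proof.
apply/shiftP/idP => [[a aA ->]|xA]; first by rewrite addrC addKr.
by exists (x - c)%R => //; rewrite addrC subrK.
Qed.

Lemma card_shift c A : #|` shift c A| = #|` A|.
Proof. by rewrite card_imfset //; apply: addrI. Qed.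

Lemma shiftS c A B : A `<=` B -> shift c A `<=` shift c B.
Proof. by move=> /fsubsetP AB; apply/fsubsetP => x; rewrite !mem_shift => /AB. Qed.

Lemma sumset0 A : sumset fset0 A = fset0.
Proof. by apply/fsetP => x; rewrite inE; apply/sumsetP => -[a [b []]]; rewrite inE. Qed.

Lemma sumset1U c C A : sumset (c |` C) A = sumset C A `|` shift c A.
Proof.
apply/fsetP => x; rewrite inE; apply/sumsetP/orP.
  move=> [a [b [+ bA ->]]]; rewrite !inE => /orP[/eqP->|aC].
    by right; apply/shiftP; exists b.
  by left; apply: mem_sumset.
case=> [/sumsetP[a [b [aC bA ->]]]|/shiftP[b bA ->]].
  by exists a, b; rewrite !inE aC orbT.
by exists c, b; rewrite !inE eqxx.
Qed.

Lemma sumset1 c A : sumset [fset c] A = shift c A.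
Proof. by rewrite -[[fset c]]fsetU0 sumset1U sumset0 fset0U. Qed.

Lemma sumsetC A B : sumset A B = sumset B A.
Proof.
by apply/fsetP => x; apply/sumsetP/sumsetP => -[a [b [aA bB ->]]];
  exists b, a; rewrite addrC.
Qed.

Lemma sumsetA A B C : sumset A (sumset B C) = sumset (sumset A B) C.
Proof.
apply/fsetP => x; apply/sumsetP/sumsetP.
  move=> [a [_ [aA /sumsetP[b [c [bB cC ->]]] ->]]].
  by exists (a + b)%R, c; rewrite addrA mem_sumset.
move=> [_ [c [/sumsetP[a [b [aA bB ->]]] cC ->]]].
by exists a, (b + c)%R; rewrite addrA mem_sumset.
Qed.

Lemma sumsetS A B C : A `<=` B -> sumset A C `<=` sumset B C.
Proof.
move=> /fsubsetP AB; apply/fsubsetP => x /sumsetP[a [c [aA cC ->]]].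
by rewrite mem_sumset // AB.
Qed.

Lemma diffset2_sumset A X : diffset2 A X = sumset A [fset (- x)%R | x in X].
Proof.
apply/fsetP => z; apply/diffset2P/sumsetP => [[a [x [aA xX ->]]]|].
  by exists a, (- x)%R; split=> //; apply/imfsetP; exists x.
by move=> [a [_ [aA /imfsetP[x /= xX ->] ->]]]; exists a, x.
Qed.

Lemma nsumS n A : nsum n.+1 A = sumset A (nsum n A).
Proof. by []. Qed.

Lemma mem_nsum n A (a : 'I_n -> G) :
  (forall i, a i \in A) -> (\sum_i a i)%R \in nsum n A.
Proof.
elim: n a => [|n IH] a aA; first by rewrite big_ord0 inE.
by rewrite big_ord_recl nsumS mem_sumset // IH.
Qed.

Lemma card_sumset_le A B : (#|` sumset A B| <= #|` A| * #|` B|)%N.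
Proof.
elim/fset1U_rect: A => [|c C cC IH]; first by rewrite sumset0.
rewrite sumset1U cardfsU1 cC mulnDl mul1n addnC.
by apply: leq_trans (leq_card_fsetU _ _) _; rewrite card_shift leq_add2r.
Qed.

(** * Plunnecke's inequality after Petridis, and Ruzsa's triangle inequality *)

Section Plunnecke.
Variable R : realFieldType.

(** Petridis's lemma: [X] minimises |Z + A| / |Z| among its own subsets, with ratio [k]. Induction
    on C: a new element c enlarges C + X + A by at most [k] times what it adds to C + X. *)
Lemma petridis A X (k : R) : 0 <= k ->
  (forall Z, Z `<=` X -> k * #|` Z|%:R <= #|` sumset Z A|%:R) ->
  #|` sumset X A|%:R <= k * #|` X|%:R ->
  forall C, #|` sumset C (sumset X A)|%:R <= k * #|` sumset C X|%:R.
Proof.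
move=> k0 Xmin Xk; elim/fset1U_rect => [|c C _ IH].
  by rewrite !sumset0 cardfs0 mulr0.
rewrite !sumset1U; set U := sumset C (sumset X A) in IH *.
set V := sumset C X in IH *.
(* Of c + X + A only the part outside c + Z + A is new, and |Z + A| >= k |Z|. *)
pose Z := [fset x in X | shift (c + x) A `<=` U].
have ZX : Z `<=` X by apply/fsubsetP => x; rewrite !inE => /andP[].
have ZU : shift c (sumset Z A) `<=` U.
  apply/fsubsetP => _ /shiftP[_ /sumsetP[z [a [+ aA ->]]] ->].
  rewrite !inE => /andP[_ /fsubsetP]; apply.
  by apply/shiftP; exists a => //; rewrite addrA.
have hU : (#|` U `|` shift c (sumset X A)| + #|` sumset Z A|
           <= #|` U| + #|` sumset X A|)%N.
  rewrite -(card_shift c (sumset X A)) -(card_shift c (sumset Z A)).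
  rewrite -[leqRHS]cardfsUI.
  rewrite leq_add2l.
  by apply/fsubset_leq_card; rewrite fsubsetI ZU shiftS // sumsetS.
(* If c + x already lies in C + X, then c + x + A lies in C + X + A, so x is in [Z]: the part of c +
   X that is not new sits inside c + Z. *)
have hV : (#|` V| + #|` X| <= #|` V `|` shift c X| + #|` Z|)%N.
  rewrite -(card_shift c X) -[leqLHS]cardfsUI leq_add2l -(card_shift c Z).
  apply/fsubset_leq_card/fsubsetP => t /fsetIP[+ /shiftP[x xX tE]]; rewrite {}tE => cxV.
  apply/shiftP; exists x => //; rewrite !inE /= xX /=.
  apply/fsubsetP => _ /shiftP[a aA ->].
  move/sumsetP: cxV => [b [y [bC yX ->]]]; rewrite -addrA mem_sumset //.
  exact: mem_sumset.
move: hU hV; rewrite -!(ler_nat R) !natrD => hU hV.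
have hZ := Xmin Z ZX.
apply: (@le_trans _ _ (k * (#|` V|%:R + #|` X|%:R - #|` Z|%:R))).
  by rewrite mulrBr mulrDr; lra.
by rewrite ler_wpM2l // lerBlDr.
Qed.

Lemma petridis_nsum A X (k : R) n : 0 <= k ->
  (forall Z, Z `<=` X -> k * #|` Z|%:R <= #|` sumset Z A|%:R) ->
  #|` sumset X A|%:R <= k * #|` X|%:R ->
  #|` sumset (nsum n A) X|%:R <= k ^+ n * #|` X|%:R.
Proof.
move=> k0 Xmin Xk; elim: n => [|n IH].
  by rewrite expr0 mul1r sumset1 card_shift.
rewrite exprS -mulrA; apply: le_trans (ler_wpM2l k0 IH).
rewrite nsumS -sumsetA sumsetC -sumsetA; exact: petridis.
Qed.

Lemma exists_seq_min (T : eqType) (F : T -> R) (s : seq T) : s != [::] ->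
  exists2 x, x \in s & forall y, y \in s -> F x <= F y.
Proof.
case: s => // x s _; elim: s x => [|y s IH] x.
  by exists x; rewrite ?inE // => y; rewrite inE => /eqP->.
have [z zs zmin] := IH y; case: (lerP (F x) (F z)) => xz.
  exists x; first by rewrite inE eqxx.
  by move=> t; rewrite inE => /orP[/eqP->//|/zmin]; apply: le_trans.
exists z; first by rewrite inE zs orbT.
by move=> t; rewrite inE => /orP[/eqP->|/zmin //]; exact: ltW.
Qed.

(** [X] minimises |X + A| / |X| over the nonempty subsets of [B], and [k] is the minimum; comparison
    with [B] itself bounds [k]. *)
Lemma petridis_subset A B : B != fset0 ->
  exists X, exists k : R, [/\ X `<=` B, X != fset0, 0 <= k,
    k * #|` B|%:R <= #|` sumset B A|%:R &
    forall n, #|` sumset (nsum n A) X|%:R <= k ^+ n * #|` X|%:R].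
Proof.
move=> B0; pose s : seq {fset G} := [seq X <- fpowerset B | X != fset0].
have Bs : B \in s by rewrite mem_filter B0 fpowersetE fsubset_refl.
have s0 : s != [::] by case: (s) Bs.
have [X Xs Xmin] :=
  exists_seq_min (fun X => #|` sumset X A|%:R / #|` X|%:R : R) s0.
move: Xs; rewrite mem_filter fpowersetE => /andP[X0 XB].
pose k : R := #|` sumset X A|%:R / #|` X|%:R.
have minP Z : Z `<=` B -> k * #|` Z|%:R <= #|` sumset Z A|%:R.
  move=> ZB; case: (altP (Z =P fset0)) => [->|Z0]; first by rewrite cardfs0 mulr0.
  rewrite -ler_pdivlMr ?ltr0n ?cardfs_gt0 //; apply: Xmin.
  by rewrite mem_filter Z0 fpowersetE.
have k0 : 0 <= k by rewrite divr_ge0.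
exists X, k; split=> // [|n]; first exact: minP.
apply: petridis_nsum => // [Z ZX|]; first by apply/minP/(fsubset_trans ZX).
by rewrite /k divfK // pnatr_eq0 cardfs_eq0.
Qed.

(** Fix one representation d = a - b for each difference d. The map (d, x) -> (a + x, b + x) is
    injective: the difference of the coordinates returns d, hence a, hence x. *)
Lemma ruzsa_triangle A B X :
  (#|` diffset2 A B| * #|` X| <= #|` sumset A X| * #|` sumset B X|)%N.
Proof.
(* The default pair is never reached for d in [diffset2 A B]. *)
pose rep d := head (0%R, 0%R)
  [seq p <- [seq (a, b) | a <- enum_fset A, b <- enum_fset B] | (p.1 - p.2)%R == d].
have repP d : d \in diffset2 A B ->
    [/\ (rep d).1 \in A, (rep d).2 \in B & ((rep d).1 - (rep d).2)%R = d].
  move=> /diffset2P[a [b [aA bB dE]]].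
  have : (a, b) \in [seq p <- [seq (a, b) | a <- enum_fset A, b <- enum_fset B]
                       | (p.1 - p.2)%R == d].
    by rewrite mem_filter /= dE eqxx /=; apply/allpairsP; exists (a, b).
  rewrite /rep; case E : [seq _ <- _ | _] => [//|p q] _ /=.
  have : p \in p :: q by rewrite inE eqxx.
  rewrite -E mem_filter => /andP[/eqP pd /allpairsP[[a' b'] [/= a'A b'B pE]]].
  by move: pd; rewrite pE /= => ->.
pose phi (u : G * G) := ((rep u.1).1 + u.2, (rep u.1).2 + u.2)%R.
pose s := [seq (d, x) | d <- enum_fset (diffset2 A B), x <- enum_fset X].
have us : uniq [seq phi u | u <- s].
  rewrite map_inj_in_uniq; first by apply: allpairs_uniq => // -[? ?] [].
  move=> _ _ /allpairsP[[d x] [/= dD xX ->]] /allpairsP[[e y] [/= eD yX ->]].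
  rewrite /phi /= => -[E1 E2].
  have [_ _ dE] := repP _ dD; have [_ _ eE] := repP _ eD.
  have de : d = e.
    have sub u v w : (u - v = (u + w) - (v + w) :> G)%R.
      by rewrite opprD addrACA subrr addr0.
    by rewrite -dE -eE (sub _ _ x) E1 E2 -sub.
  by congr (_, _) => //; move: E1; rewrite de => /addrI.
have := @uniq_leq_size _ _ [seq (c, d) | c <- enum_fset (sumset A X),
                             d <- enum_fset (sumset B X)] us.
rewrite size_map !size_allpairs; apply=> u /mapP[_ /allpairsP[[d x] [/= dD xX ->]] ->].
have [repA repB _] := repP _ dD; apply/allpairsP.
by exists (phi (d, x)); split => //; rewrite /phi /= mem_sumset.
Qed.

(** The minimising subset X controls both nA + X and mA + X; the triangle inequality through X
    combines the two bounds and cancels one factor |X|. *)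
Lemma plunnecke A B (L : R) n m : B != fset0 ->
  #|` sumset B A|%:R <= L * #|` B|%:R ->
  #|` diffset2 (nsum n A) (nsum m A)|%:R <= L ^+ (n + m) * #|` B|%:R.
Proof.
move=> B0 BL; have [X [k [XB X0 k0 kL kX]]] := petridis_subset A B0.
have X1 : 0 < #|` X|%:R :> R by rewrite ltr0n cardfs_gt0.
have B1 : 0 < #|` B|%:R :> R by rewrite ltr0n cardfs_gt0.
have {}kL : k <= L by rewrite -(ler_pM2r B1); apply: le_trans BL.
apply: (@le_trans _ _ (k ^+ (n + m) * #|` X|%:R)).
  rewrite -(ler_pM2r X1); apply: (@le_trans _ _ (#|` sumset (nsum n A) X|%:R *
     #|` sumset (nsum m A) X|%:R)).
    by rewrite -!natrM ler_nat ruzsa_triangle.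
  rewrite (_ : _ * _ * _ = (k ^+ n * #|` X|%:R) * (k ^+ m * #|` X|%:R)).
    exact: ler_pM.
  by rewrite exprD; ring.
apply: ler_pM => //; first exact: exprn_ge0.
  by rewrite lerXn2r ?nnegrE // (le_trans k0).
by rewrite ler_nat fsubset_leq_card.
Qed.

(** * Ruzsa's covering lemma and growth of sumsets under bounded doubling *)

(** Greedy choice: the translates s + X, s in [S], are disjoint, which the cardinality equation
    records. A y whose translate meets S + X lies in S + X - X; any other y is added to [S]. *)
Lemma ruzsa_covering X Y : exists S : {fset G},
  [/\ S `<=` Y, (#|` S| * #|` X| = #|` sumset S X|)%N &
   (X != fset0 -> Y `<=` sumset S (diffset2 X X))].
Proof.
elim/fset1U_rect: Y => [|y Y _ [S [SY SX YS]]].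
  by exists fset0; rewrite fsub0set sumset0 cardfs0 mul0n.
case: (boolP (y \in sumset S (diffset2 X X))) => yS.
  exists S; split=> //; first by rewrite (fsubset_trans SY) ?fsubsetU1.
  move=> X0; apply/fsubsetP => z; rewrite !inE => /orP[/eqP->//|].
  exact/fsubsetP/YS.
have dis : sumset S X `&` shift y X = fset0.
  apply/fsetP => z; rewrite !inE; apply: contraNF yS => /andP[].
  move=> /sumsetP[s [x [sS xX zE]]] /shiftP[x' x'X zE'].
  have -> : y = (s + (x - x'))%R by rewrite addrA -zE zE' addrK.
  by rewrite mem_sumset // mem_diffset2.
case: (altP (X =P fset0)) => [X0|X0].
  exists fset0; rewrite fsub0set sumset0 cardfs0 mul0n; split => //.
have yNS : y \notin S.
  apply: contra yS => yS; have [x xX] := fset0Pn _ X0.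
  by rewrite -[y]addr0 -(subrr x) mem_sumset // mem_diffset2.
exists (y |` S); split=> [||_].
- by rewrite fsetUS.
- rewrite sumset1U cardfsU1 yNS mulnDl mul1n SX addnC.
  by have := cardfsUI (sumset S X) (shift y X); rewrite dis cardfs0 addn0 card_shift.
- apply/fsubsetP => z; rewrite !inE => /orP[/eqP->|/(fsubsetP (YS X0)) zS].
    have [x xX] := fset0Pn _ X0.
    by have := mem_sumset (fset1U1 y S) (mem_diffset2 xX xX); rewrite subrr addr0.
  exact/(fsubsetP (sumsetS _ (fsubsetUr _ _))).
Qed.

(** A sum of n elements of [S] depends only on the multiplicity of each element, a number between 0
    and n. *)
Lemma card_nsum_poly n S : (#|` nsum n S| <= n.+1 ^ #|` S|)%N.
Proof.
pose F (m : nat) (c : {ffun S -> 'I_m.+1}) : G := (\sum_s val s *+ c s)%R.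
have FP x : x \in nsum n S ->
    exists2 c : S -> nat, (\sum_s c s = n)%N & x = (\sum_s val s *+ c s)%R.
  elim: n x => [|m IH] x.
    rewrite inE => /eqP->; exists (fun=> 0%N); first by rewrite big1.
    by rewrite big1.
  move=> /sumsetP[s [y [sS /IH[c cm ->] ->]]].
  exists (fun t => (t == [` sS]) + c t)%N.
    rewrite big_split /= cm (bigD1 [` sS]) //= eqxx big1 ?addn0 // => i /negbTE->.
    by [].
  under [RHS]eq_bigr do rewrite mulrnDr.
  rewrite big_split /= [X in _ = (X + _)%R](bigD1 [` sS]) //= eqxx mulr1n.
  by rewrite [X in (_ + X + _)%R]big1 ?addr0 // => i /negbTE->.
have sub : nsum n S `<=` [fset F n c | c in {: {ffun S -> 'I_n.+1}}].
  apply/fsubsetP => x /FP[c cn ->]; apply/imfsetP => /=.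
  exists [ffun s => inord (c s)] => //.
  apply: eq_bigr => s _; rewrite ffunE inordK // ltnS -cn.
  by rewrite (bigD1 s) //= leq_addr.
apply: leq_trans (fsubset_leq_card sub) _.
apply: leq_trans (leq_imfset_card _ _ _) _.
by rewrite -cardE card_ffun card_ord cardfE.
Qed.

(** Each use of the covering trades one summand from [X] for one from the fixed set [S], so that (n
    + 1)X - X lies in nS + X - X. *)
Lemma covering_growth X S n : X != fset0 ->
  diffset2 (nsum 2 X) X `<=` sumset S (diffset2 X X) ->
  (#|` diffset2 (nsum n X) X| <= n.+1 ^ #|` S| * #|` diffset2 X X|)%N.
Proof.
move=> X0 /fsubsetP cov; have [x0 x0X] := fset0Pn _ X0.
case: n => [|n].
  rewrite exp1n mul1n.
  have -> : diffset2 (nsum 0 X) X = [fset (- x)%R | x in X].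
    apply/fsetP => z; apply/diffset2P/imfsetP => /= [[a [x [+ xX ->]]]|[x xX ->]].
      by rewrite inE => /eqP->; exists x; rewrite // sub0r.
    by exists 0%R, x; rewrite inE eqxx sub0r.
  apply: leq_trans (leq_imfset_card _ _ _) _.
  rewrite -(card_shift (- x0) X); apply/fsubset_leq_card/fsubsetP => z.
  by move=> /shiftP[x xX ->]; rewrite addrC mem_diffset2.
have sub : diffset2 (nsum n.+1 X) X `<=` sumset (nsum n S) (diffset2 X X).
  apply/fsubsetP; elim: n => [|n IH] z.
    rewrite sumset1 => /diffset2P[a [x [/sumsetP[b [c [bX + ->]]] xX ->]]].
    rewrite inE => /eqP->; rewrite addr0; apply/shiftP.
    by exists (b - x)%R; rewrite ?mem_diffset2 ?add0r.
  move=> /diffset2P[_ [x [/sumsetP[b [c [bX cX ->]]] xX ->]]].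
  have /sumsetP[s [_ [sS /diffset2P[y [y' [yX y'X ->]]] E]]] :=
    IH _ (mem_diffset2 cX xX).
  have : (b + y - y')%R \in diffset2 (nsum 2 X) X.
    rewrite mem_diffset2 //; apply: mem_sumset => //.
    by rewrite -[y]addr0; apply: mem_sumset; rewrite // inE.
  move=> /cov/sumsetP[s' [w [s'S wX E']]].
  have -> : (b + c - x = (s' + s) + w)%R.
    by rewrite -addrA E addrCA [(b + _)%R]addrA E' addrCA addrA.
  by rewrite mem_sumset // mem_sumset.
apply: leq_trans (fsubset_leq_card sub) _.
apply: leq_trans (card_sumset_le _ _) _; rewrite leq_mul // (leq_trans (card_nsum_poly _ _)) //.
by case: #|` S| => [|k]; rewrite ?expn0 ?leq_exp2r.
Qed.

End Plunnecke.
End Sumsets.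

(** (n + 1)^s is at most (n + 1)...(n + s), which is s! times a binomial coefficient of n + s.
    Polynomial growth is thus absorbed by the base 2 and a constant depending on s. *)
Lemma leq_expS_exp2 n s : (n.+1 ^ s <= s`! * 2 ^ s * 2 ^ n)%N.
Proof.
have H : (n.+1 ^ s <= (n + s) ^_ s)%N.
  elim: s => [|s IH]; first by rewrite expn0 ffactn0.
  by rewrite expnS addnS ffactSS leq_mul // ltnS leq_addr.
apply: leq_trans H _; rewrite -bin_ffact mulnC -mulnA leq_mul2l -expnD [(s + n)%N]addnC.
apply/orP; right.
have := expnDn 1 1 (n + s); rewrite addn1 => ->.
have sn : (s < (n + s).+1)%N by rewrite ltnS leq_addl.
rewrite (bigD1 (Ordinal sn)) //= !exp1n !muln1.
exact: leq_addr.
Qed.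

(** The base of the power is 2 whatever [L] is: the dependence on [L] is confined to the constant in
    front. *)
Lemma bounded_doubling_growth (R : archiRealFieldType) (L : R) : exists2 C : R, 0 < C &
  forall (G : zmodType) (X : {fset G}), X != fset0 ->
    #|` diffset2 X X|%:R <= L * #|` X|%:R ->
    forall n m, #|` diffset2 (nsum n X) (nsum m X)|%:R <=
      C * 2 ^+ (n + m) * #|` X|%:R.
Proof.
(* [s] bounds the covering set of 2X - X: |S| |X| = |S + X| <= |3X - X| <= L^4 |X|, by Plunnecke's
   inequality with B = -X. *)
pose s := Num.bound (L ^+ 4); pose c : R := (s`! * 2 ^ s)%:R * `|L|.
(* Each of nX - X and mX - X costs a factor c; the added 1 keeps the constant positive when c =
   0. *)
exists (c ^+ 2 + 1)%R; first by rewrite ltr_wpDl // sqr_ge0.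
move=> G X X0 XL n m.
pose oX := [fset (- x)%R | x in X]; have minE A := diffset2_sumset A X.
have oXX : #|` oX| = #|` X| by rewrite card_imfset //; apply: oppr_inj.
have oX0 : oX != fset0 by rewrite -cardfs_gt0 oXX cardfs_gt0.
have X1 : 0 < #|` X|%:R :> R by rewrite ltr0n cardfs_gt0.
have nsum1 : nsum 1 X = X.
  rewrite nsumS sumsetC sumset1; apply/fsetP => z.
  by rewrite mem_shift subr0.
have [S [SY SX cov]] := ruzsa_covering X (diffset2 (nsum 2 X) X).
have Ss : (#|` S| <= s)%N.
  have : #|` diffset2 (nsum 3 X) (nsum 1 X)|%:R <= L ^+ (3 + 1) * #|` oX|%:R.
    by apply: plunnecke => //; rewrite sumsetC -minE oXX.
  rewrite nsum1 oXX => H; rewrite -(ler_nat R) ltW //.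
  apply: le_lt_trans (archi_boundP _); last first.
    by rewrite exprn_even_ge0.
  rewrite -(ler_pM2r X1) -natrM SX; apply: le_trans H; rewrite ler_nat.
  apply/fsubset_leq_card/fsubsetP => z /sumsetP[t [x [/(fsubsetP SY)]]].
  move=> /diffset2P[u [v [u2 vX ->]] xX ->].
  by rewrite addrAC mem_diffset2 // addrC nsumS mem_sumset.
have half k : #|` diffset2 (nsum k X) X|%:R <= c * 2 ^+ k * #|` X|%:R.
  apply: (@le_trans _ _ ((k.+1 ^ s)%:R * (`|L| * #|` X|%:R))).
    apply: (@le_trans _ _ ((k.+1 ^ #|` S| * #|` diffset2 X X|)%:R)).
      by rewrite ler_nat covering_growth // cov.
    rewrite natrM ler_pM //; first by rewrite ler_nat leq_pexp2l.
    by apply: le_trans XL _; rewrite ler_pM2r // ler_norm.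
  rewrite /c mulrA ler_pM2r // mulrAC ler_wpM2r //.
  by rewrite -natrX -natrM ler_nat leq_expS_exp2.
rewrite -(ler_pM2r X1); apply: (@le_trans _ _ (#|` diffset2 (nsum n X) X|%:R *
     #|` diffset2 (nsum m X) X|%:R)).
  by rewrite -natrM -{1}oXX -natrM ler_nat !minE ruzsa_triangle.
apply: le_trans (ler_pM _ _ (half n) (half m)) _ => //.
rewrite exprD -subr_ge0.
have -> : ((c ^+ 2 + 1) * (2 ^+ n * 2 ^+ m) * #|` X|%:R * #|` X|%:R
   - c * 2 ^+ n * #|` X|%:R * (c * 2 ^+ m * #|` X|%:R)
   = (2 ^+ n * 2 ^+ m) * #|` X|%:R * #|` X|%:R)%R by ring.
by rewrite !mulr_ge0 // exprn_ge0.
Qed.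

(** * Weighted dependent random choice *)

Section Sums.
Variable R : realFieldType.

Lemma cauchy_schwarz (I : Type) (s : seq I) (f g : I -> R) :
  (\sum_(i <- s) f i * g i) ^+ 2 <=
  (\sum_(i <- s) f i ^+ 2) * (\sum_(i <- s) g i ^+ 2).
Proof.
pose F := \sum_(i <- s) f i ^+ 2; pose H := \sum_(i <- s) f i * g i.
pose E := \sum_(i <- s) g i ^+ 2; rewrite -/F -/H -/E.
have Fge0 : 0 <= F by apply: sumr_ge0 => i _; apply: sqr_ge0.
have Q t : 0 <= F * t ^+ 2 + E - 2 * t * H.
  have -> : F * t ^+ 2 + E - 2 * t * H = \sum_(i <- s) (f i * t - g i) ^+ 2.
    rewrite mulr_suml mulr_sumr -big_split -sumrB /=; apply: eq_bigr => i _.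
    by ring.
  by apply: sumr_ge0 => i _; apply: sqr_ge0.
case: (ltrgt0P F) Fge0 => // F0 _.
  have := Q (H / F); rewrite -(pmulr_rge0 _ F0).
  have -> : F * (F * (H / F) ^+ 2 + E - 2 * (H / F) * H) = F * E - H ^+ 2.
    by field; rewrite gt_eqF.
  by rewrite subr_ge0.
have [->|H0] := eqVneq H 0; first by rewrite F0 mul0r expr0n.
(* With F = 0 the quadratic is affine in t, and this t would give it the value -1. *)
have := Q ((E + 1) / (2 * H)).
have -> : F * ((E + 1) / (2 * H)) ^+ 2 + E - 2 * ((E + 1) / (2 * H)) * H = -1.
  by rewrite F0; field.
by rewrite ler0N1.
Qed.

Lemma ler_sum_inj (I J : eqType) (s : seq I) (t : seq J) (phi : I -> J)
    (F : I -> R) (h : J -> R) :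
  uniq s -> uniq t -> {in s &, injective phi} -> {in t, forall y, 0 <= h y} ->
  {in s, forall i, phi i \notin t -> F i <= 0} ->
  {in s, forall i, phi i \in t -> F i <= h (phi i)} ->
  \sum_(i <- s) F i <= \sum_(y <- t) h y.
Proof.
move=> us ut phi_inj h0 Fnt Ft.
apply: (@le_trans _ _ (\sum_(y <- map phi s | y \in t) h y)).
  rewrite big_map [leRHS]big_mkcond /= [leLHS]big_seq [leRHS]big_seq.
  by apply: ler_sum => i si; case: ifP => [/Ft->//|/negbT/Fnt->].
rewrite [leRHS](bigID (mem (map phi s))) /= -big_filter -[X in _ <= X + _]big_filter.
rewrite (perm_big [seq i <- t | i \in map phi s]) /=.
  rewrite lerDl big_seq_cond sumr_ge0 // => y /andP[yt _]; exact: h0.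
apply: uniq_perm; rewrite ?filter_uniq ?map_inj_in_uniq // => y.
by rewrite !mem_filter andbC.
Qed.

Lemma exists_sum_gt0 (I : eqType) (s : seq I) (F : I -> R) :
  0 < \sum_(i <- s) F i -> exists2 i, i \in s & 0 < F i.
Proof.
move=> sF; apply/hasP; apply: contraTT sF => /hasPn sF.
rewrite -leNgt big_seq; apply: sumr_le0 => i /sF; by rewrite -leNgt.
Qed.

Section DependentChoice.
Variables (I : eqType) (s : seq I) (m : I -> R) (k : I -> I -> R) (W J : R).
Hypotheses (m0 : forall x, 0 <= m x) (k0 : forall x y, 0 <= k x y).
Hypotheses (W0 : 0 < W) (J0 : 0 < J).
Hypothesis mW : \sum_(x <- s) m x <= W.
Hypothesis mJ : J <= \sum_(x <- s) \sum_(z <- s) m x * m z * k x z.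

(** For the measure [m] and edge weights [k], the sum is the weighted number of common neighbours of
    x and y. Its mean over pairs is at least J^2 / W^3; a good pair reaches a sixteenth of that. *)
Definition good_pair (x y : I) : bool :=
  J ^+ 2 / (16 * W ^+ 3) <= \sum_(z <- s) m z * k x z * k y z.

(** Pick z at random according to [m], with weighted degree d z. [Q] keeps the x whose bad partners
    among the neighbours of z weigh at most d z / 4, so two of them share good partners of weight at
    least d z / 2, where d z >= J / (2W). *)
Lemma weighted_dependent_choice : exists z (Q : pred I),
  J / (4 * W) <= \sum_(x <- s | Q x) m x * k x z /\
  forall x x', Q x -> Q x' ->
    J / (4 * W) <= \sum_(y <- s | good_pair x y && good_pair x' y) m y * k y z.
Proof.
pose d z := \sum_(x <- s) m x * k x z.
pose B z := \sum_(x <- s) \sum_(y <- s | ~~ good_pair x y) m x * k x z * (m y * k y z).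
have md : J <= \sum_(z <- s) m z * d z.
  apply: le_trans mJ _; rewrite exchange_big /= le_eqVlt; apply/orP; left; apply/eqP.
  by apply: eq_bigr => z _; rewrite /d mulr_sumr; apply: eq_bigr => x _; ring.
(* Cauchy-Schwarz as a variance about J / W, a form suited to a total mass only known to be at most
   [W]. *)
have md2 : J ^+ 2 / W <= \sum_(z <- s) m z * d z ^+ 2.
  have : 0 <= \sum_(z <- s) m z * (d z - J / W) ^+ 2.
    by apply: sumr_ge0 => z _; rewrite mulr_ge0 ?sqr_ge0.
  have -> : \sum_(z <- s) m z * (d z - J / W) ^+ 2 =
     \sum_(z <- s) m z * d z ^+ 2 - (2 * (J / W)) * \sum_(z <- s) m z * d z
     + (J / W) ^+ 2 * \sum_(z <- s) m z.
    by rewrite !mulr_sumr -sumrB -big_split /=; apply: eq_bigr => z _; ring.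
  have JW : 0 < J / W by rewrite divr_gt0.
  have h1 : 2 * (J / W) * J <= 2 * (J / W) * \sum_(z <- s) m z * d z.
    by rewrite ler_pM2l // mulr_gt0.
  have h2 : (J / W) ^+ 2 * \sum_(z <- s) m z <= (J / W) ^+ 2 * W.
    by rewrite ler_pM2l // exprn_gt0.
  have e1 : 2 * (J / W) * J = 2 * (J ^+ 2 / W) by ring.
  have e2 : (J / W) ^+ 2 * W = J ^+ 2 / W by field; rewrite gt_eqF.
  lra.
have mB : \sum_(z <- s) m z * B z <= J ^+ 2 / (16 * W).
  have -> : \sum_(z <- s) m z * B z = \sum_(x <- s) \sum_(y <- s | ~~ good_pair x y)
     m x * m y * \sum_(z <- s) m z * k x z * k y z.
    under eq_bigr do rewrite /B mulr_sumr.
    rewrite exchange_big /=; apply: eq_bigr => x _.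
    under eq_bigr do rewrite mulr_sumr.
    rewrite exchange_big /=; apply: eq_bigr => y _.
    by rewrite mulr_sumr; apply: eq_bigr => z _; ring.
  pose e := J ^+ 2 / (16 * W ^+ 3).
  have e0 : 0 <= e by rewrite divr_ge0 ?mulr_ge0 ?exprn_ge0 // ltW.
  apply: (@le_trans _ _ (\sum_(x <- s) \sum_(y <- s) m x * m y * e)).
    apply: ler_sum => x _; rewrite big_mkcond /=; apply: ler_sum => y _.
    case: ifP => [|_]; last by apply: mulr_ge0 => //; apply: mulr_ge0.
    by rewrite -ltNge => /ltW ce; apply: ler_wpM2l => //; apply: mulr_ge0.
  have -> : \sum_(x <- s) \sum_(y <- s) m x * m y * e = (\sum_(x <- s) m x) ^+ 2 * e.
    rewrite expr2 -mulrA [RHS]mulr_suml; apply: eq_bigr => x _.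
    by rewrite mulr_suml mulr_sumr; apply: eq_bigr => y _; rewrite mulrA.
  have -> : J ^+ 2 / (16 * W) = W ^+ 2 * e by rewrite /e; field; rewrite gt_eqF.
  by rewrite ler_wpM2r // lerXn2r ?nnegrE ?sumr_ge0 // ltW.
have [z _ mz] : exists2 z, z \in s &
    0 < m z * (d z ^+ 2 - 8 * B z - (J / (2 * W)) ^+ 2).
  (* A bad pair has little weight on average over z, by its very definition, so
     some z sees few of them among its d z ^ 2 pairs. *)
  apply: exists_sum_gt0.
  have -> : \sum_(z <- s) m z * (d z ^+ 2 - 8 * B z - (J / (2 * W)) ^+ 2) =
    \sum_(z <- s) m z * d z ^+ 2 - 8 * \sum_(z <- s) m z * B z
    - (J / (2 * W)) ^+ 2 * \sum_(z <- s) m z.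
    by rewrite !mulr_sumr -!sumrB; apply: eq_bigr => z _; ring.
  have h : (J / (2 * W)) ^+ 2 * \sum_(z <- s) m z <= (J / (2 * W)) ^+ 2 * W.
    by rewrite ler_wpM2l ?sqr_ge0.
  have e1 : (J / (2 * W)) ^+ 2 * W = J ^+ 2 / W / 4 by field; rewrite gt_eqF.
  have e2 : J ^+ 2 / (16 * W) = J ^+ 2 / W / 16 by field; rewrite gt_eqF.
  (* What remains is at least (1 - 1/2 - 1/4) J^2 / W. *)
  have : 0 < J ^+ 2 / W by rewrite divr_gt0 ?exprn_gt0.
  lra.
have {}mz : 8 * B z + (J / (2 * W)) ^+ 2 < d z ^+ 2.
  have : 0 < d z ^+ 2 - 8 * B z - (J / (2 * W)) ^+ 2.
    by move: mz; apply: contraTT; rewrite -!leNgt => /(mulr_ge0_le0 (m0 z)).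
  lra.
have mk0 x : 0 <= m x * k x z by rewrite mulr_ge0.
have d0 : 0 <= d z by rewrite sumr_ge0.
have B0 : 0 <= B z by rewrite sumr_ge0 // => x _; rewrite sumr_ge0 // => y _; rewrite mulr_ge0.
have dJ : J / (2 * W) <= d z.
  rewrite -(@ler_pXn2r _ 2) ?nnegrE // ?divr_ge0 ?mulr_ge0 // ?ltW //.
  by apply: le_lt_trans mz; rewrite lerDr mulr_ge0.
have JW4 : J / (4 * W) = J / (2 * W) / 2 by field; rewrite gt_eqF.
have JW0 : 0 < J / (2 * W) by rewrite divr_gt0 ?mulr_gt0.
pose bad x := \sum_(y <- s | ~~ good_pair x y) m y * k y z.
pose Q x := bad x <= d z / 4.
exists z, Q; split=> [|x x' Qx Qx'].
  have dQ : d z = \sum_(x <- s | Q x) m x * k x z + \sum_(x <- s | ~~ Q x) m x * k x z.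
    by rewrite /d (bigID Q).
  suff : \sum_(x <- s | ~~ Q x) m x * k x z <= d z / 2 by lra.
  (* Markov's inequality: each x outside [Q] has more than d z / 4 of bad partners, and 8 B z < (d
     z)^2. *)
  have : (\sum_(x <- s | ~~ Q x) m x * k x z) * (d z / 4) <= B z.
    rewrite mulr_suml big_mkcond /=; apply: ler_sum => x _.
    rewrite -mulr_sumr; case: ifP => [|_]; last by rewrite mulr_ge0 // sumr_ge0.
    by rewrite -ltNge => /ltW; apply: ler_wpM2l.
  have dz0 : 0 < d z by apply: lt_le_trans dJ.
  have : 0 <= (J / (2 * W)) ^+ 2 by apply: sqr_ge0.
  move=> ? ?; rewrite -(@ler_pM2r _ (d z / 4)) ?divr_gt0 //.
  have : d z / 2 * (d z / 4) = d z ^+ 2 / 8 by field.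
  lra.
have : d z <= \sum_(y <- s | good_pair x y && good_pair x' y) m y * k y z + bad x + bad x'.
  rewrite /d /bad [X in _ <= X + _ + _]big_mkcond [X in _ <= _ + X + _]big_mkcond.
  rewrite [X in _ <= _ + X]big_mkcond /=.
  rewrite -!big_split /=; apply: ler_sum => y _.
  have := mk0 y; case: (good_pair x y); case: (good_pair x' y) => /=; lra.
move: Qx Qx'; rewrite /Q; lra.
Qed.

End DependentChoice.

(** Weighted form of [corr], which is the case where [h] is the indicator function of [Q]. Applied
    twice, starting from f^2, it yields the fourfold convolution. *)
Definition autocorr (G : zmodType) (Q : {fset G}) (h : G -> R) (v : G) : R :=
  \sum_(q <- Q) h q * h (q + v).

Section Autocorr.
Variables (G : zmodType) (Q : {fset G}) (h : G -> R).
Hypotheses (h0 : forall x, 0 <= h x) (hQ : forall x, x \notin Q -> h x = 0).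

Lemma autocorr_ge0 v : 0 <= autocorr Q h v.
Proof. by apply: sumr_ge0 => q _; rewrite mulr_ge0. Qed.

Lemma autocorr_eq0 v : v \notin diffset Q -> autocorr Q h v = 0.
Proof.
move=> vQ; rewrite /autocorr big_seq big1 // => q qQ.
rewrite [X in _ * X]hQ ?mulr0 //; apply: contra vQ => qvQ.
by apply/imfset2P; exists q => //; exists (q + v); rewrite // addrC addKr.
Qed.

Lemma sum_autocorr_le (T : {fset G}) :
  \sum_(t <- T) autocorr Q h t <= (\sum_(q <- Q) h q) ^+ 2.
Proof.
rewrite exchange_big /= expr2 mulr_suml; apply: ler_sum => q _.
rewrite -mulr_sumr ler_wpM2l //.
apply: (ler_sum_inj (phi := fun t => q + t) (fset_uniq _) (fset_uniq _)) => //.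
- by move=> x y _ _ /addrI.
- by move=> x _ /hQ->.
Qed.

Lemma le_autocorr (T : {fset G}) a b :
  \sum_(t <- T) h (t - a) * h (t - b) <= autocorr Q h (a - b).
Proof.
apply: (ler_sum_inj (phi := fun t => t - a) (fset_uniq _) (fset_uniq _)) => //.
- by move=> x y _ _ /addIr.
- by move=> x _; rewrite mulr_ge0.
- by move=> x _ /hQ->; rewrite mul0r.
- by move=> x _ _; rewrite addrA subrK.
Qed.

End Autocorr.

End Sums.

(** * Correlations *)

Section Correlation.
Variables (R : realFieldType) (G : zmodType) (A : {fset G}).
Let D := diffset A.
Let f (x : G) : R := (corr A x)%:R.

Lemma corr_sum x : f x = \sum_(c <- A) (c + x \in A)%:R.
Proof.
rewrite /f /corr; have -> : [fset p in A `*` A | p.2 - p.1 == x]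
    = [fset (c, c + x) | c in [fset c in A | c + x \in A]].
  apply/fsetP => -[a b]; rewrite !inE /=; apply/idP/imfsetP => /=.
    move=> /andP[/andP[aA bA] /eqP <-]; exists a; rewrite ?inE addrC subrK //=.
    by rewrite aA.
  by move=> [c]; rewrite !inE => /andP[cA cxA] [-> ->]; rewrite cA cxA addrC addKr /=.
rewrite card_imfset; last by move=> c d [].
rewrite -natr_sum -big_mkcond /= sum1_count -size_filter; congr (_%:R).
by apply/perm_size/uniq_perm => [||c]; rewrite ?filter_uniq ?fset_uniq // !(inE, mem_filter) andbC.
Qed.

Lemma corr_ge0 x : 0 <= f x. Proof. exact: ler0n. Qed.

Lemma corrN x : f (- x) = f x.
Proof.
have le y : f (- y) <= f y.
  rewrite !corr_sum; apply: (ler_sum_inj (phi := fun c => c - y) (fset_uniq _) (fset_uniq _)) => //.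
  - by move=> a b _ _ /addIr.
  - by move=> c _ /negbTE->.
  - by move=> c cA ->; rewrite subrK cA.
by apply/eqP; rewrite eq_le le /= -{1}(opprK x) le.
Qed.

Lemma sum_corr_shift a (F : G -> R) : a \in A ->
  \sum_(c <- A) F (c - a) = \sum_(x <- D) (a + x \in A)%:R * F x.
Proof.
move=> aA; rewrite -(big_map (fun c => c - a) xpredT F).
under [RHS]eq_bigr do rewrite mulr_natl mulrb.
rewrite -big_mkcond -[RHS]big_filter /=; apply: perm_big; apply: uniq_perm.
- by rewrite map_inj_uniq ?fset_uniq //; apply: addIr.
- by rewrite filter_uniq ?fset_uniq.
move=> x; rewrite mem_filter; apply/mapP/andP => [[c cA ->]|[axA xD]].
  by rewrite addrC subrK; split=> //; apply/imfset2P; exists a => //; exists c.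
by exists (a + x); rewrite // addrC addKr.
Qed.

Lemma sum_corr (h : G -> R) :
  \sum_(a <- A) \sum_(b <- A) h (b - a) = \sum_(x <- D) f x * h x.
Proof.
rewrite big_seq; under eq_bigr do rewrite sum_corr_shift //.
rewrite -big_seq exchange_big /=; apply: eq_bigr => x _.
by rewrite corr_sum mulr_suml.
Qed.

Lemma sum_corr2_le (Q : {fset G}) a b :
  \sum_(x <- Q) (a + x \in A)%:R * (b + x \in A)%:R <= f (b - a).
Proof.
rewrite corr_sum; apply: (ler_sum_inj (phi := fun x => a + x) (fset_uniq _) (fset_uniq _)) => //.
- by move=> x y _ _ /addrI.
- by move=> x _ /negbTE->; rewrite mul0r.
- by move=> x _ ->; rewrite mul1r addrAC addrCA subrr addr0.
Qed.

Lemma corr_eq0R x : x \notin D -> f x = 0.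
Proof. by move=> /corr_eq0 xD; rewrite /f xD. Qed.

Lemma diffsetN x : (- x \in D) = (x \in D).
Proof.
have H y : y \in D -> - y \in D.
  move=> /imfset2P[a aA [b bA ->]]; rewrite opprB.
  by apply/imfset2P; exists b => //; exists a.
by apply/idP/idP => /H; rewrite ?opprK.
Qed.

Lemma sum_corr_diff_le (Q : {fset G}) (h : R -> R) z : h 0 = 0 ->
  (forall y, 0 <= y -> 0 <= h y) ->
  \sum_(x <- Q) h (f (x - z)) <= \sum_(x <- D) h (f x).
Proof.
move=> h0 hge; apply: (ler_sum_inj (phi := fun x => x - z) (fset_uniq _) (fset_uniq _)) => //.
- by move=> x y _ _ /addIr.
- by move=> y _; rewrite hge ?corr_ge0.
- by move=> x _ /corr_eq0R->; rewrite h0.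
Qed.

(** Group the pairs by x = c - a and apply Cauchy-Schwarz in x. Expanding the second factor leaves,
    for each a and b, the number of x with a + x and b + x both in A, at most f(b - a). *)
Lemma corr_smoothing (alpha u : G -> R) : (forall x, 0 <= alpha x) ->
  (\sum_(a <- A) \sum_(c <- A) alpha a * u (c - a)) ^+ 2 <=
  (\sum_(x <- D) u x ^+ 2) *
  (\sum_(a <- A) \sum_(b <- A) alpha a * alpha b * f (b - a)).
Proof.
move=> alpha0.
pose g x := \sum_(a <- A) alpha a * (a + x \in A)%:R.
have -> : \sum_(a <- A) \sum_(c <- A) alpha a * u (c - a) = \sum_(x <- D) u x * g x.
  rewrite [LHS]big_seq; under eq_bigr => a aA.
    rewrite -mulr_sumr sum_corr_shift // mulr_sumr; over.
  rewrite -big_seq exchange_big /=; apply: eq_bigr => x _.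
  by rewrite mulr_sumr; apply: eq_bigr => a _; ring.
apply: le_trans (cauchy_schwarz _ _ _) _; apply: ler_wpM2l.
  by apply: sumr_ge0 => x _; apply: sqr_ge0.
have -> : \sum_(x <- D) g x ^+ 2 = \sum_(a <- A) \sum_(b <- A) alpha a * alpha b *
     \sum_(x <- D) (a + x \in A)%:R * (b + x \in A)%:R.
  under eq_bigr do rewrite expr2 /g mulr_suml.
  rewrite exchange_big /=; apply: eq_bigr => a _.
  under eq_bigr do rewrite mulr_sumr.
  rewrite exchange_big /=; apply: eq_bigr => b _.
  by rewrite mulr_sumr; apply: eq_bigr => x _; ring.
apply: ler_sum => a _; apply: ler_sum => b _.
by apply: ler_wpM2l; rewrite ?mulr_ge0 ?sum_corr2_le.
Qed.

Lemma triple_corr_le (u : G -> R) : (forall x, 0 <= u x) ->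
  (\sum_(b <- A) \sum_(a <- A) \sum_(c <- A) u (a - b) * u (c - b) * f (c - a)) ^+ 2
  <= (\sum_(x <- D) f x ^+ 3) *
     \sum_(x <- D) \sum_(y <- D) u x ^+ 2 * u y ^+ 2 * f (y - x) ^+ 2.
Proof.
move=> u0.
(* C3 (x, y) = |A n (A - x) n (A - y)| has second moment E_3(A): count the pairs
   b, b' of A in it by their difference t; for each t this gives f(t)^3. *)
pose C3 (p : G * G) := \sum_(b <- A) (b + p.1 \in A)%:R * (b + p.2 \in A)%:R : R.
pose g (p : G * G) := u p.1 * u p.2 * f (p.2 - p.1).
pose s := [seq (x, y) | x <- enum_fset D, y <- enum_fset D].
(* Substitute x = a - b and y = c - b; then c - a = y - x, and b only enters through [C3]. *)
have -> : \sum_(b <- A) \sum_(a <- A) \sum_(c <- A) u (a - b) * u (c - b) * f (c - a)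
   = \sum_(p <- s) C3 p * g p.
  rewrite big_allpairs /=.
  transitivity (\sum_(b <- A) \sum_(x <- D) \sum_(y <- D)
     (b + x \in A)%:R * (b + y \in A)%:R * g (x, y)).
    rewrite big_seq [RHS]big_seq; apply: eq_bigr => b bA.
    pose H x := \sum_(y <- D) (b + y \in A)%:R * g (x, y).
    have E a : \sum_(c <- A) u (a - b) * u (c - b) * f (c - a) = H (a - b).
      rewrite /H -(sum_corr_shift (fun y => g (a - b, y)) bA).
      by apply: eq_bigr => c _; rewrite /g /= opprB addrA subrK.
    under eq_bigr do rewrite E.
    rewrite (sum_corr_shift _ bA); apply: eq_bigr => x _.
    by rewrite mulr_sumr; apply: eq_bigr => y _; rewrite mulrA.
  rewrite exchange_big; apply: eq_bigr => x _ /=.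
  by rewrite exchange_big; apply: eq_bigr => y _ /=; rewrite /C3 mulr_suml.
apply: le_trans (cauchy_schwarz _ _ _) _; apply: ler_pM.
- by apply: sumr_ge0 => p _; apply: sqr_ge0.
- by apply: sumr_ge0 => p _; apply: sqr_ge0.
- have -> : \sum_(p <- s) C3 p ^+ 2 = \sum_(a <- A) \sum_(b <- A)
       (\sum_(x <- D) (a + x \in A)%:R * (b + x \in A)%:R) ^+ 2.
    under eq_bigr do rewrite expr2 /C3 mulr_suml.
    rewrite exchange_big /=; apply: eq_bigr => a _.
    under eq_bigr do rewrite mulr_sumr.
    rewrite exchange_big /=; apply: eq_bigr => b _.
    rewrite big_allpairs /= expr2 mulr_suml; apply: eq_bigr => x _.
    by rewrite mulr_sumr; apply: eq_bigr => y _; ring.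
  apply: (@le_trans _ _ (\sum_(a <- A) \sum_(b <- A) f (b - a) ^+ 2)).
    apply: ler_sum => a _; apply: ler_sum => b _.
    rewrite lerXn2r ?nnegrE ?sum_corr2_le //; first by apply: sumr_ge0 => x _; rewrite mulr_ge0.
  by rewrite (sum_corr (fun x => f x ^+ 2)); under eq_bigr do rewrite -exprS.
by rewrite big_allpairs /= ; apply: ler_sum => x _; apply: ler_sum => y _; rewrite !exprMn.
Qed.

(** Values of f above lam = 2 E3 / s contribute at most E3 / lam = s / 2 to the sum of squares. The
    other half of the mass comes from terms at most lam^2. *)
Lemma card_ge_of_mass (Q : {fset G}) z (s E3 : R) : 0 < s -> 0 < E3 ->
  \sum_(x <- D) f x ^+ 3 <= E3 -> s <= \sum_(x <- Q) f (x - z) ^+ 2 ->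
  s / (2 * (2 * E3 / s) ^+ 2) <= #|` Q|%:R.
Proof.
move=> s0 E0 fE sQ; pose lam := 2 * E3 / s; rewrite -/lam.
have lam0 : 0 < lam by rewrite divr_gt0 ?mulr_gt0.
have H : \sum_(x <- Q) f (x - z) ^+ 2 <= lam ^+ 2 * #|` Q|%:R + E3 / lam.
  apply: (@le_trans _ _ (\sum_(x <- Q) (lam ^+ 2 + f (x - z) ^+ 3 / lam))).
    apply: ler_sum => x _; have := corr_ge0 (x - z); move: (f (x - z)) => y y0.
    rewrite -(ler_pM2r lam0) mulrDl divfK ?gt_eqF //.
    case: (lerP y lam) => yl.
      apply: ler_wpDr; first exact: exprn_ge0.
      by rewrite ler_pM2r // lerXn2r ?nnegrE // ltW.
    apply: ler_wpDl; first by rewrite mulr_ge0 ?exprn_ge0 // ltW.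
    by rewrite (exprSr y 2) ler_wpM2l ?exprn_ge0 // ltW.
  rewrite big_split /= -[X in _ + X <= _]mulr_suml big_const_seq count_predT iter_addr addr0 mulr_natr.
  rewrite lerD2l ler_pM2r ?invr_gt0 //; apply: le_trans fE.
  by apply: (sum_corr_diff_le Q (h := fun y => y ^+ 3)) => [|y y0]; rewrite ?expr0n ?exprn_ge0.
have E : E3 / lam = s / 2 by rewrite /lam; field; rewrite !gt_eqF.
rewrite ler_pdivrMr; last by apply: mulr_gt0 => //; apply: exprn_gt0.
lra.
Qed.

(** The same truncation in the smooth form y^2 <= lam y + y^3 / lam; the last term again costs only
    s / 2. *)
Lemma sum_corr_ge_of_mass (Q : {fset G}) z (s E3 : R) : 0 < s -> 0 < E3 ->
  \sum_(x <- D) f x ^+ 3 <= E3 -> s <= \sum_(x <- Q) f (x - z) ^+ 2 ->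
  s ^+ 2 / (4 * E3) <= \sum_(x <- Q) f (x - z).
Proof.
move=> s0 E0 fE sQ; pose lam := 2 * E3 / s.
have lam0 : 0 < lam by rewrite divr_gt0 ?mulr_gt0.
have H : \sum_(x <- Q) f (x - z) ^+ 2 <= lam * \sum_(x <- Q) f (x - z) + E3 / lam.
  apply: (@le_trans _ _ (\sum_(x <- Q) (lam * f (x - z) + f (x - z) ^+ 3 / lam))).
    apply: ler_sum => x _; have := corr_ge0 (x - z); move: (f (x - z)) => y y0.
    rewrite -(ler_pM2r lam0) mulrDl divfK ?gt_eqF // -subr_ge0.
    have -> : lam * y * lam + y ^+ 3 - y ^+ 2 * lam =
       y * ((lam / 2 - y) ^+ 2 + 3 / 4 * lam ^+ 2) by field.
    apply: mulr_ge0 => //; apply: addr_ge0; first exact: sqr_ge0.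
    by apply: mulr_ge0; [apply: divr_ge0 | apply: sqr_ge0].
  rewrite big_split /= -mulr_suml -mulr_sumr.
  rewrite lerD2l ler_pM2r ?invr_gt0 //; apply: le_trans fE.
  by apply: (sum_corr_diff_le Q (h := fun y => y ^+ 3)) => [|y y0]; rewrite ?expr0n ?exprn_ge0.
have E : E3 / lam = s / 2 by rewrite /lam; field; rewrite !gt_eqF.
have E' : s ^+ 2 / (4 * E3) = (s / 2) / lam by rewrite /lam; field; rewrite !gt_eqF.
rewrite E' ler_pdivrMr //; lra.
Qed.

(* Going through any y in P good for both x and x', the difference x - x' is in
   many ways a signed sum of four elements, each counted with weight f^2; the
   fourfold convolution of f^2 has total mass at most W ^ 4. *)
Lemma small_doubling_subset (P : {fset G}) (W E3 Lam J : R) :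
  0 < W -> 0 < E3 -> 0 < Lam -> 0 < J ->
  {in P, forall x, f x <= Lam} ->
  \sum_(x <- D) f x ^+ 2 <= W -> \sum_(x <- P) f x ^+ 2 <= W ->
  \sum_(x <- D) f x ^+ 3 <= E3 ->
  J <= \sum_(x <- P) \sum_(y <- P) f x ^+ 2 * f y ^+ 2 * f (x - y) ^+ 2 ->
  let s := J / (4 * W * Lam ^+ 2) in
  let n0 := s / (2 * (2 * E3 / s) ^+ 2) in
  exists z (X : {fset G}),
  [/\ X `<=` P, n0 <= #|` X|%:R, s ^+ 2 / (4 * E3) <= \sum_(x <- X) f (x - z) &
     #|` diffset2 X X|%:R * ((J ^+ 2 / (16 * W ^+ 3) / Lam ^+ 2) ^+ 2 * n0) <= W ^+ 4].
Proof.
move=> W0 E0 L0 J0 PL fW PW fE PJ s n0.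
have s0 : 0 < s by rewrite divr_gt0 ?mulr_gt0 ?exprn_gt0.
pose r x := f x ^+ 2.
have r0 x : 0 <= r x by apply: exprn_ge0; apply: corr_ge0.
have rD x : x \notin D -> r x = 0 by move=> /corr_eq0R; rewrite /r => ->; rewrite expr0n.
have [z [Q [Q1 Q2]]] := @weighted_dependent_choice R G P r (fun x y => r (x - y)) W J
   r0 (fun x y => r0 _) W0 J0 PW PJ.
pose gp := @good_pair R G P r (fun x y => r (x - y)) W J.
(* Bounding the weight f(x)^2 by Lam^2 turns weighted mass J / (4W) into unweighted mass [s]. *)
have mass (Y : pred G) : J / (4 * W) <= \sum_(x <- P | Y x) r x * r (x - z) ->
    s <= \sum_(x <- [fset x in P | Y x]) f (x - z) ^+ 2.
  move=> H; rewrite -big_fset_condE /= /s invfM mulrA ler_pdivrMr ?exprn_gt0 //.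
  apply: le_trans H _; rewrite mulr_suml [leLHS]big_seq_cond [leRHS]big_seq_cond.
  apply: ler_sum => x /andP[xP _]; rewrite mulrC ler_wpM2l ?r0 //.
  by rewrite lerXn2r ?nnegrE ?corr_ge0 ?PL // ltW.
pose X := [fset x in P | Q x].
exists z, X; split.
- by apply/fsubsetP => x; rewrite !inE => /andP[].
- exact/(card_ge_of_mass s0 E0 fE)/mass/Q1.
- exact/(sum_corr_ge_of_mass s0 E0 fE)/mass/Q1.
pose R2 := autocorr D r; pose R4 := autocorr (diffset D) R2.
have R20 v : 0 <= R2 v by apply: autocorr_ge0.
have R2D v : v \notin diffset D -> R2 v = 0 by apply: autocorr_eq0.
pose e := J ^+ 2 / (16 * W ^+ 3); rewrite -/e.
have e0 : 0 < e by rewrite divr_gt0 ?mulr_gt0 ?exprn_gt0.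
(* A common neighbour t has weight f(t)^2 f(x - t)^2 f(y - t)^2; the first factor is at most Lam^2,
   and the evenness of f makes the rest a term of [R2] at y - x. *)
have goodR x y : gp x y -> e / Lam ^+ 2 <= R2 (y - x).
  rewrite ler_pdivrMr ?exprn_gt0 // => H; apply: le_trans H _.
  apply: (@le_trans _ _ ((\sum_(t <- P) r (t - y) * r (t - x)) * Lam ^+ 2)); last first.
    by rewrite ler_pM2r ?exprn_gt0 // le_autocorr.
  rewrite mulr_suml [leLHS]big_seq [leRHS]big_seq; apply: ler_sum => t tP.
  rewrite -mulrA mulrC [r (x - t) * _]mulrC /r.
  rewrite -(corrN (x - t)) -(corrN (y - t)) !opprB ler_wpM2l ?mulr_ge0 ?exprn_ge0 ?corr_ge0 //.
  by rewrite lerXn2r ?nnegrE ?corr_ge0 ?PL // ltW.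
have R4X x x' : x \in X -> x' \in X -> (e / Lam ^+ 2) ^+ 2 * n0 <= R4 (x - x').
  rewrite !inE /= => /andP[_ Qx] /andP[_ Qx'].
  (* Each y in [S] writes x - x' as (y - x') - (y - x) and contributes at least (e / Lam^2)^2;
     [mass] supplies at least [n0] such y. *)
  pose S := [fset y in P | gp x y && gp x' y].
  apply: (@le_trans _ _ (\sum_(y <- S) R2 (y - x) * R2 (y - x'))); last first.
    exact: le_autocorr.
  apply: (@le_trans _ _ (\sum_(y <- S) (e / Lam ^+ 2) ^+ 2)).
    rewrite big_const_seq count_predT iter_addr addr0 -[leRHS]mulr_natr ler_wpM2l ?sqr_ge0 //.
    exact/(card_ge_of_mass s0 E0 fE)/mass/Q2.
  rewrite [leLHS]big_seq [leRHS]big_seq; apply: ler_sum => y; rewrite !inE /=.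
  move=> /and3P[_ gx gx']; rewrite expr2; apply: ler_pM; rewrite ?goodR //;
    by rewrite divr_ge0 ?exprn_ge0 // ltW.
apply: (@le_trans _ _ (\sum_(t <- diffset2 X X) R4 t)).
  apply: (@le_trans _ _ (\sum_(t <- diffset2 X X) ((e / Lam ^+ 2) ^+ 2 * n0))).
    by rewrite big_const_seq count_predT iter_addr addr0 mulr_natl.
  rewrite [leLHS]big_seq [leRHS]big_seq; apply: ler_sum => t.
  by move=> /diffset2P[x [x' [xX x'X ->]]]; apply: R4X.
apply: le_trans (sum_autocorr_le R20 R2D _) _.
have SR : \sum_(q <- diffset D) R2 q <= W ^+ 2.
  apply: le_trans (sum_autocorr_le r0 rD _) _.
  by rewrite lerXn2r ?nnegrE ?sumr_ge0 // ltW.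
rewrite (exprM W 2 2) lerXn2r ?nnegrE ?sumr_ge0 //; exact: exprn_ge0 (ltW W0).
Qed.

End Correlation.

Lemma sumr_const_fset (R : pzRingType) (T : choiceType) (Q : {fset T}) (c : R) :
  \sum_(x <- Q) c = c * #|` Q|%:R.
Proof. by rewrite big_const_seq count_predT iter_addr addr0 mulr_natr. Qed.

(** * Popular differences *)

Section Popular.
Variables (R : realFieldType) (G : zmodType) (A : {fset G}) (K M : R).
Let D := diffset A.
Let N : R := #|` A|%:R.
Let f (x : G) : R := (corr A x)%:R.
Hypotheses (A0 : A != fset0) (K0 : 0 < K) (M0 : 0 < M).
Hypothesis f2 : \sum_(x <- D) f x ^+ 2 = N ^+ 3 / K.
Hypothesis f3 : \sum_(x <- D) f x ^+ 3 = M * N ^+ 4 / K ^+ 2.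

Let N0 : 0 < N. Proof. by rewrite ltr0n cardfs_gt0. Qed.
Let f0 x : 0 <= f x. Proof. exact: ler0n. Qed.

Definition popular : {fset G} :=
  [fset x in D | (N / (4 * K) <= f x) && (f x <= 4 * M * N / K)].

Lemma sum_corr1 : \sum_(x <- D) f x = N ^+ 2.
Proof.
have := @sum_corr R G A (fun=> 1); rewrite sumr_const_fset sumr_const_fset mul1r expr2.
by under eq_bigr do rewrite mulr1.
Qed.

(** The differences below the lower cut carry at most N / (4K) times the sum N^2 of f, those above
    the upper cut at most K / (4MN) times the third moment. Each is a quarter of the energy. *)
Lemma popular_energy : N ^+ 3 / (2 * K) <= \sum_(x <- popular) f x ^+ 2.
Proof.
have H : \sum_(x <- D) f x ^+ 2 <= \sum_(x <- popular) f x ^+ 2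
    + N / (4 * K) * \sum_(x <- D) f x + K / (4 * M * N) * \sum_(x <- D) f x ^+ 3.
  rewrite /popular -big_fset_condE /= [X in _ <= X + _ + _]big_mkcond /=.
  rewrite !mulr_sumr -!big_split /=; apply: ler_sum => x _.
  have := f0 x; move: (f x) => y y0.
  have t1 : 0 <= N / (4 * K) * y by rewrite mulr_ge0 // divr_ge0 ?mulr_ge0 // ltW.
  have t2 : 0 <= K / (4 * M * N) * y ^+ 3.
    by rewrite mulr_ge0 ?exprn_ge0 // divr_ge0 ?mulr_ge0 // ltW.
  have y2 : 0 <= y ^+ 2 by apply: sqr_ge0.
  case: ifP => [_|]; first lra.
  move=> /negbT; rewrite negb_and -!ltNge => /orP[yl|yl].
    have : y ^+ 2 <= N / (4 * K) * y by rewrite expr2 ler_wpM2r // ltW.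
    lra.
  suff : y ^+ 2 <= K / (4 * M * N) * y ^+ 3 by lra.
  rewrite mulrAC ler_pdivlMr ?mulr_gt0 //.
  have : 4 * M * N <= K * y by rewrite [K * y]mulrC -ler_pdivrMr //; apply: ltW.
  move=> /(ler_wpM2l y2); rewrite (exprSr y 2); lra.
move: H; rewrite f2 f3 sum_corr1.
have -> : N / (4 * K) * N ^+ 2 = N ^+ 3 / K / 4 by field; rewrite gt_eqF.
have -> : K / (4 * M * N) * (M * N ^+ 4 / K ^+ 2) = N ^+ 3 / K / 4.
  by field; rewrite !gt_eqF.
have -> : N ^+ 3 / (2 * K) = N ^+ 3 / K / 2 by field; rewrite gt_eqF.
lra.
Qed.

Lemma sum_popular_le (h : R -> R) : (forall y, 0 <= y -> 0 <= h y) ->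
  \sum_(x <- popular) h (f x) <= \sum_(x <- D) h (f x).
Proof.
move=> h0; rewrite /popular -big_fset_condE big_mkcond /=.
by apply: ler_sum => x _; case: ifP => // _; apply: h0.
Qed.

Lemma card_popular : #|` popular|%:R <= 4 * K * N.
Proof.
have : \sum_(x <- popular) N / (4 * K) <= N ^+ 2.
  rewrite -sum_corr1; apply: le_trans (sum_popular_le (h := id) _) => //.
  rewrite [leLHS]big_seq [leRHS]big_seq.
  by apply: ler_sum => x; rewrite !inE => /and3P[].
rewrite sumr_const_fset mulrAC ler_pdivrMr ?mulr_gt0 // => H.
rewrite -(ler_pM2l N0); apply: le_trans H _; rewrite le_eqVlt; apply/orP; left; apply/eqP.
by ring.
Qed.

Let u (x : G) : R := if x \in popular then f x else 0.

Let u0 x : 0 <= u x. Proof. by rewrite /u; case: ifP. Qed.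

Lemma popularN x : (- x \in popular) = (x \in popular).
Proof. by rewrite !inE /= diffsetN /f !(@corrN R). Qed.

Let uN x : u (- x) = u x.
Proof. by rewrite /u popularN /f corrN. Qed.

Let sumD (F : G -> R) : \sum_(x <- popular) F x =
  \sum_(x <- D) if x \in popular then F x else 0.
Proof.
rewrite {1}/popular -big_fset_condE /= big_mkcond [LHS]big_seq [RHS]big_seq.
by apply: eq_bigr => x xD; rewrite !inE /= xD.
Qed.

Let sumr_sqr_le (F : G -> R) : (\sum_(a <- A) F a) ^+ 2 <= N * \sum_(a <- A) F a ^+ 2.
Proof.
have := cauchy_schwarz A (fun=> 1) F.
under eq_bigr do rewrite mul1r.
by under [X in _ <= X * _ -> _]eq_bigr do rewrite expr1n; rewrite sumr_const_fset mul1r.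
Qed.

(** [S] is the weight of popular pairs and [V b] that of paths b, a, c with popular steps.
    Cauchy-Schwarz over the middle vertex gives S^2 <= N sum V; over b, followed by smoothing, it
    gives (sum V)^2 <= (N^4 / K) T. *)
Lemma popular_triples : N ^+ 6 / (16 * K ^+ 3) <=
  \sum_(b <- A) \sum_(a <- A) \sum_(c <- A) u (a - b) * u (c - b) * f (c - a).
Proof.
set T := \sum_(b <- A) _.
pose S := \sum_(a <- A) \sum_(b <- A) u (b - a).
have SE : N ^+ 3 / (2 * K) <= S.
  rewrite /S sum_corr; apply: le_trans popular_energy _.
  rewrite sumD; apply: ler_sum => x _; rewrite /u; case: ifP => _ //.
  by rewrite mulr0.
pose V b := \sum_(a <- A) \sum_(c <- A) u (a - b) * u (c - a).
have VE : S ^+ 2 <= N * \sum_(b <- A) V b.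
  apply: le_trans (sumr_sqr_le _) _; rewrite ler_pM2l // /V exchange_big /=.
  apply: ler_sum => a _; rewrite expr2 mulr_suml; apply: ler_sum => b _.
  by rewrite mulr_sumr; apply: ler_sum => c _; rewrite -(uN (a - b)) opprB.
have VT : (\sum_(b <- A) V b) ^+ 2 <= N ^+ 4 / K * T.
  apply: le_trans (sumr_sqr_le _) _.
  have -> : N ^+ 4 / K * T = N * (N ^+ 3 / K * T) by ring.
  rewrite ler_pM2l // /T mulr_sumr; apply: ler_sum => b _.
  (* Smoothing replaces the path from b by two popular edges at b, the third side c - a now carrying
     the full weight f. *)
  apply: le_trans (@corr_smoothing R G A (fun a => u (a - b)) u _) _ => //.
  apply: ler_wpM2r.
    by do 2!apply: sumr_ge0 => ? _; rewrite !mulr_ge0.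
  rewrite -f2; apply: ler_sum => x _; rewrite /u; case: ifP => // _.
  by rewrite expr0n sqr_ge0.
have V0 : 0 <= \sum_(b <- A) V b.
  by do 3!apply: sumr_ge0 => ? _; rewrite mulr_ge0.
have S4 : (N ^+ 3 / (2 * K)) ^+ 4 <= N ^+ 2 * (N ^+ 4 / K * T).
  apply: (@le_trans _ _ ((S ^+ 2) ^+ 2)).
    by rewrite -exprM lerXn2r ?nnegrE ?(le_trans _ SE) // divr_ge0 ?mulr_ge0 ?exprn_ge0 // ltW.
  apply: (@le_trans _ _ ((N * \sum_(b <- A) V b) ^+ 2)).
    by rewrite lerXn2r ?nnegrE ?sqr_ge0 // mulr_ge0 // ltW.
  by rewrite exprMn ler_pM2l // exprn_gt0.
have c0 : 0 < N ^+ 6 / K by rewrite divr_gt0 ?exprn_gt0.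
rewrite -(ler_pM2l c0); apply: le_trans (le_trans S4 _); rewrite le_eqVlt.
  by apply/orP; left; apply/eqP; field; rewrite gt_eqF.
by apply/orP; left; apply/eqP; field; rewrite gt_eqF.
Qed.

Lemma popular_quadruples : N ^+ 8 / (256 * K ^+ 4 * M) <=
  \sum_(x <- popular) \sum_(y <- popular) f x ^+ 2 * f y ^+ 2 * f (x - y) ^+ 2.
Proof.
have := @triple_corr_le R G A u u0; rewrite -/f f3.
have -> : \sum_(x <- popular) \sum_(y <- popular) f x ^+ 2 * f y ^+ 2 * f (x - y) ^+ 2
  = \sum_(x <- D) \sum_(y <- D) u x ^+ 2 * u y ^+ 2 * f (y - x) ^+ 2.
  rewrite sumD; apply: eq_bigr => x _; rewrite /u; case: ifP => _; last first.
    by rewrite big1 // => y _; rewrite expr0n !mul0r.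
  rewrite sumD; apply: eq_bigr => y _; case: ifP => _; last first.
    by rewrite expr0n mulr0 mul0r.
  by rewrite -(opprB y x) /f corrN.
set J := \sum_(x <- D) _ => H.
have T0 : 0 <= N ^+ 6 / (16 * K ^+ 3).
  by rewrite divr_ge0 ?mulr_ge0 ?exprn_ge0 // ltW.
have {}H : (N ^+ 6 / (16 * K ^+ 3)) ^+ 2 <= M * N ^+ 4 / K ^+ 2 * J.
  apply: le_trans H; have := popular_triples => H.
  by rewrite lerXn2r ?nnegrE ?(le_trans _ H).
have c0 : 0 < M * N ^+ 4 / K ^+ 2 by rewrite divr_gt0 ?mulr_gt0 ?exprn_gt0.
rewrite -(ler_pM2l c0); apply: le_trans H; rewrite le_eqVlt.
by apply/orP; left; apply/eqP; field; rewrite !gt_eqF.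
Qed.

End Popular.

(** * From popular differences back to a subset of A *)

(** Translating every summand by -t translates nA - mA by mt - nt, which leaves its size
    unchanged. *)
Lemma sumdiff_shift (G : zmodType) (A X : {fset G}) (t : G) n m :
  {in A, forall a, (a - t)%R \in X} ->
  (#|` sumdiff n m A| <= #|` diffset2 (nsum n X) (nsum m X)|)%N.
Proof.
move=> AX; rewrite -[leqRHS](card_shift (t *+ n - t *+ m)%R).
apply/fsubset_leq_card/fsubsetP => _ /imfset2P[/= a _ [b _ ->]].
have red k (c : {ffun 'I_k -> A}) : (\sum_i val (c i) - t *+ k)%R \in nsum k X.
  have -> : (\sum_i val (c i) - t *+ k)%R = (\sum_(i < k) (val (c i) - t))%R.
    by rewrite sumrB sumr_const card_ord.
  by apply: mem_nsum => i; apply: AX; apply: valP.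
apply/shiftP; exists ((\sum_i val (a i) - t *+ n) - (\sum_j val (b j) - t *+ m))%R.
  exact: mem_diffset2.
by rewrite opprB [RHS]addrACA addKr [(t *+ n + _)%R]addrC subrK.
Qed.

Lemma structured_subset (R : realFieldType) (G : zmodType) (A : {fset G}) (K M : R) :
  A != fset0 -> 0 < K -> 0 < M ->
  \sum_(x <- diffset A) (corr A x)%:R ^+ 2 = #|` A|%:R ^+ 3 / K ->
  \sum_(x <- diffset A) (corr A x)%:R ^+ 3 = M * #|` A|%:R ^+ 4 / K ^+ 2 ->
  exists (A' X : {fset G}) (t : G),
  [/\ A' `<=` A, {in A', forall a, (a - t)%R \in X},
      #|` A|%:R / (2 ^+ 31 * M ^+ 7) <= #|` A'|%:R,
      X != fset0 /\ #|` X|%:R <= 4 * K * #|` A|%:R &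
      #|` diffset2 X X|%:R <= 2 ^+ 138 * M ^+ 30 * #|` X|%:R].
Proof.
move=> A0 K0 M0 f2 f3; set N : R := #|` A|%:R in f2 f3 *.
have N0 : 0 < N by rewrite ltr0n cardfs_gt0.
pose P := popular A K M.
have W0 : 0 < N ^+ 3 / K by rewrite divr_gt0 ?exprn_gt0.
have E0 : 0 < M * N ^+ 4 / K ^+ 2 by rewrite divr_gt0 ?mulr_gt0 ?exprn_gt0.
have L0 : 0 < 4 * M * N / K by rewrite divr_gt0 ?mulr_gt0.
have J0 : 0 < N ^+ 8 / (256 * K ^+ 4 * M) by rewrite divr_gt0 ?mulr_gt0 ?exprn_gt0.
have PL : {in P, forall x, (corr A x)%:R <= 4 * M * N / K}.
  by move=> x; rewrite !inE => /and3P[].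
have PW : \sum_(x <- P) (corr A x)%:R ^+ 2 <= N ^+ 3 / K.
  rewrite -f2; apply: (sum_popular_le A K M (h := fun y => y ^+ 2)) => y y0.
  exact: exprn_ge0.
have fW : \sum_(x <- diffset A) (corr A x)%:R ^+ 2 <= N ^+ 3 / K by rewrite f2.
have fE : \sum_(x <- diffset A) (corr A x)%:R ^+ 3 <= M * N ^+ 4 / K ^+ 2 by rewrite f3.
have /= := small_doubling_subset W0 E0 L0 J0 PL fW PW fE
  (popular_quadruples A0 K0 M0 f2 f3).
set s := _ / (4 * _ * _ ^+ 2).
have sE : s = N ^+ 3 / (2 ^+ 14 * M ^+ 3 * K) by rewrite /s; field; rewrite !gt_eqF.
set n0 := s / _.
have n0E : n0 = N * K / (2 ^+ 45 * M ^+ 11) by rewrite /n0 sE; field; rewrite !gt_eqF.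
set rho := (_ ^+ 2 * n0)%R.
have rhoE : rho = N ^+ 11 / (2 ^+ 93 * M ^+ 19 * K ^+ 5).
  by rewrite /rho n0E; field; rewrite !gt_eqF.
have -> : s ^+ 2 / (4 * (M * N ^+ 4 / K ^+ 2)) = N ^+ 2 / (2 ^+ 30 * M ^+ 7).
  by rewrite sE; field; rewrite !gt_eqF.
move=> [z [X [XP Xn0 Xs Xd]]].
have n00 : 0 < n0 by rewrite n0E divr_gt0 ?mulr_gt0 ?exprn_gt0.
have rho0 : 0 < rho by rewrite rhoE divr_gt0 ?mulr_gt0 ?exprn_gt0.
(* On average over c in A, the translate X + c - z captures a positive
   proportion of A. *)
pose Ac c := [fset a in A | (a - (c - z))%R \in X].
have XAc : \sum_(x <- X) (corr A (x - z))%:R <= \sum_(c <- A) #|` Ac c|%:R :> R.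
  under eq_bigr do rewrite corr_sum.
  rewrite exchange_big /=; apply: ler_sum => c _.
  rewrite -[leRHS]mul1r -sumr_const_fset.
  apply: (ler_sum_inj (phi := fun x => (c + (x - z))%R) (fset_uniq _) (fset_uniq _)) => //.
  - by move=> x y _ _ /addrI/addIr.
  - move=> x xX; rewrite !inE /= opprD opprK addrACA subrr add0r subrK xX andbT.
    by move=> /negbTE->.
  - by move=> x _ _; rewrite lern1 leq_b1.
(* The average over c is at least N / (2^30 M^7); half of it makes the inequality strict. *)
have [c cA Ac_large] : exists2 c, c \in A &
    0 < #|` Ac c|%:R - N / (2 ^+ 31 * M ^+ 7) :> R.
  apply: exists_sum_gt0; rewrite sumrB sumr_const_fset -/N.
  have := le_trans Xs XAc.
  have -> : N ^+ 2 / (2 ^+ 30 * M ^+ 7) = 2 * (N / (2 ^+ 31 * M ^+ 7) * N).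
    by field; rewrite !gt_eqF.
  have : 0 < N / (2 ^+ 31 * M ^+ 7) * N.
    by rewrite mulr_gt0 // divr_gt0 ?mulr_gt0 ?exprn_gt0.
  move: (N / _ * N)%R => w; lra.
exists (Ac c), X, (c - z)%R; split.
- by apply/fsubsetP => a; rewrite !inE => /andP[].
- by move=> a; rewrite !inE => /andP[].
- by move: Ac_large; rewrite subr_gt0 => /ltW.
- split; first by rewrite -cardfs_gt0 -(ltr0n R) (lt_le_trans n00).
  apply: le_trans _ (card_popular M A0 K0); rewrite ler_nat; exact: fsubset_leq_card.
rewrite -(ler_pM2r rho0); apply: le_trans Xd _.
(* W^4 / rho = 2^93 M^19 N K = 2^138 M^30 n0, and n0 <= |X|. *)
have c0 : 0 < 2 ^+ 138 * M ^+ 30 * rho by apply: mulr_gt0 => //; rewrite mulr_gt0 ?exprn_gt0.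
rewrite [leRHS]mulrAC; apply: le_trans _ (ler_wpM2l (ltW c0) Xn0); rewrite le_eqVlt.
by apply/orP; left; apply/eqP; rewrite rhoE n0E; field; rewrite !gt_eqF.
Qed.

(** * Signs and sizes of the parameters, and the conclusion *)

Lemma sum_corr_pos (R : realFieldType) (G : zmodType) (A : {fset G}) k :
  A != fset0 -> (0 < k)%N ->
  0 < \sum_(x <- diffset A) (corr A x)%:R ^+ k :> R.
Proof.
move=> A0 k0; apply: (@lt_le_trans _ _ (#|` A|%:R ^+ 2)).
  by rewrite exprn_gt0 // ltr0n cardfs_gt0.
rewrite -sum_corr1; apply: ler_sum => x _; rewrite -natrX ler_nat.
by case: (corr A x) => // j; rewrite -[leqLHS]expn1 leq_pexp2l.
Qed.

Lemma energy_le (R : realFieldType) (G : zmodType) (A : {fset G}) :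
  \sum_(x <- diffset A) (corr A x)%:R ^+ 2 <= #|` A|%:R ^+ 3 :> R.
Proof.
rewrite (exprS _ 2) -sum_corr1 mulr_sumr; apply: ler_sum => x _.
rewrite expr2 ler_wpM2r // corr_sum -[leRHS]mul1r -sumr_const_fset.
by apply: ler_sum => c _; rewrite lern1 leq_b1.
Qed.

Lemma card_sumdiff00 (G : zmodType) (A : {fset G}) : (#|` sumdiff 0 0 A| <= 1)%N.
Proof.
rewrite -(cardfs1 (0 : G)); apply/fsubset_leq_card/fsubsetP => _ /imfset2P[/= a _ [b _ ->]].
by rewrite !big_ord0 subr0 inE.
Qed.

(** The constants precede the group and the set, hence are absolute. A finite subgroup has K = M = 1
    and log M = 0, so the bounds are read with max(M, 2) in place of M. *)
Theorem theorem3 (R : realType) :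
  exists c C : R, [/\ 0 < c, 0 < C &
    forall (G : zmodType) (A : {fset G}) (K M : R),
      A != fset0 ->
      (energy A)%:R = (#|` A|)%:R ^+ 3 / K ->
      (energy3 A)%:R = M * (#|` A|)%:R ^+ 4 / K ^+ 2 ->
      let M2 := Num.max M 2 in
      exists A' : {fset G},
        [/\ A' `<=` A,
            c * (M2 ^- 10 * log2 M2 ^- 15 * (#|` A|)%:R) <= (#|` A'|)%:R &
            forall n m : nat,
              (#|` sumdiff n m A'|)%:R <=
                C * ((M2 ^+ 9 * log2 M2 ^+ 14) ^+ (6 * (n + m)) * K
                     * (#|` A'|)%:R)]].
Proof.
have [C1 C10 grow] := bounded_doubling_growth (2 ^+ 138 * (2 ^+ 10) ^+ 30 : R).
(* One summand for each case: n = m = 0, M2 >= 2^10, and M2 < 2^10, where 103 = 33 + 7 * 10. *)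
pose C : R := (1 + 2 ^+ 33 + C1 * 2 ^+ 103)%R.
have t0 k : 0 < 2 ^+ k :> R by rewrite exprn_gt0.
have CC1 : 0 < C1 * 2 ^+ 103 by rewrite mulr_gt0.
have [Ca Cb Cc C0] : [/\ 1 <= C, 2 ^+ 33 <= C, C1 * 2 ^+ 103 <= C & 0 < C].
  by move: (t0 33%N) CC1; rewrite /C; split; lra.
exists (2 ^- 31), C; split => //; first by rewrite invr_gt0.
move=> G A K M A0 hE hE3 M2.
have f2 : \sum_(x <- diffset A) (corr A x)%:R ^+ 2 = #|` A|%:R ^+ 3 / K.
  by rewrite -hE /energy natr_sum; apply: eq_bigr => x _; rewrite natrX.
have f3 : \sum_(x <- diffset A) (corr A x)%:R ^+ 3 = M * #|` A|%:R ^+ 4 / K ^+ 2.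
  by rewrite -hE3 /energy3 natr_sum; apply: eq_bigr => x _; rewrite natrX.
set N : R := #|` A|%:R in f2 f3 *.
have N0 : 0 < N by rewrite ltr0n cardfs_gt0.
have K0 : 0 < K.
  have := sum_corr_pos R A0 (isT : 0 < 2)%N.
  by rewrite f2 pmulr_rgt0 ?exprn_gt0 // invr_gt0.
have M0 : 0 < M.
  have := sum_corr_pos R A0 (isT : 0 < 3)%N.
  by rewrite f3 pmulr_lgt0 ?invr_gt0 ?exprn_gt0 // pmulr_lgt0 ?exprn_gt0.
have K1 : 1 <= K.
  have := energy_le R A; rewrite f2 ler_pdivrMr // -[leLHS]mulr1.
  by rewrite ler_pM2l // exprn_gt0.
have [MM2 M22] : M <= M2 /\ 2 <= M2 by rewrite /M2 !le_max !lexx orbT.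
have M21 : 1 <= M2 by apply: le_trans M22; rewrite ler1n.
have M20 : 0 < M2 by apply: lt_le_trans M22.
have l1 : 1 <= log2 M2.
  rewrite /log2 ler_pdivlMr ?mul1r ?ln_gt0 ?ltr1n //.
  by rewrite ler_ln ?posrE.
have M2ge0 := ltW M20.
clearbody M2; move: (log2 M2) l1 => l l1.
have [A' [X [t [A'A A'X A'N [X0 XK] XX]]]] := structured_subset A0 K0 M0 f2 f3.
have M7 : M ^+ 7 <= M2 ^+ 7 by rewrite lerXn2r ?nnegrE // ltW.
have NA' : N <= 2 ^+ 31 * M2 ^+ 7 * #|` A'|%:R.
  move: A'N; rewrite ler_pdivrMr ?mulr_gt0 ?exprn_gt0 // => /le_trans; apply.
  by rewrite mulrC ler_wpM2r // ler_pM2l.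
have A'1 : 1 <= #|` A'|%:R :> R.
  rewrite ler1n lt0n; apply: contraTneq NA' => ->.
  by rewrite mulr0 -ltNge.
exists A'; split => // [|n m].
  have l15 : 1 <= l ^+ 15 by rewrite exprn_ege1.
  have l0 : 0 < l by apply: lt_le_trans l1.
  have M3 : 1 <= M2 ^+ 3 by rewrite exprn_ege1.
  have -> : (2 ^- 31 * (M2 ^- 10 * l ^- 15 * N) =
      N / (2 ^+ 31 * M2 ^+ 10 * l ^+ 15))%R.
    by rewrite !invfM; ring.
  rewrite ler_pdivrMr ?mulr_gt0 ?exprn_gt0 //; apply: le_trans NA' _.
  have -> : (#|` A'|%:R * (2 ^+ 31 * M2 ^+ 10 * l ^+ 15) =
     2 ^+ 31 * M2 ^+ 7 * #|` A'|%:R * (M2 ^+ 3 * l ^+ 15))%R by ring.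
  rewrite ler_peMr //; first by rewrite !mulr_ge0 ?exprn_ge0 // ltW.
  by rewrite -[leLHS]mulr1 ler_pM.
(* With exponent 0 no power of M2 is available to absorb the loss M2^7 in |X|; but then the set is
   at most a point, and K and |A'| are at least 1. *)
have [nm0|nm0] := posnP (n + m).
  move/eqP: nm0; rewrite addn_eq0 => /andP[/eqP-> /eqP->].
  rewrite muln0 expr0 mul1r; apply: (@le_trans _ _ 1).
    by rewrite lern1 card_sumdiff00.
  by rewrite -[leLHS]mulr1 ler_pM // -[leLHS]mulr1 ler_pM.
(* 54 = 9 * 6, the logarithm being at least 1. *)
have B54 : M2 ^+ (54 * (n + m)) <= (M2 ^+ 9 * l ^+ 14) ^+ (6 * (n + m)).
  rewrite (_ : 54 * (n + m) = 9 * (6 * (n + m)))%N; last by rewrite mulnA.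
  have M9 : 0 <= M2 ^+ 9 by rewrite exprn_ge0 // ltW.
  have l14 : 1 <= l ^+ 14 by rewrite exprn_ege1.
  have h : M2 ^+ 9 <= M2 ^+ 9 * l ^+ 14 by rewrite ler_peMr.
  by rewrite exprM lerXn2r ?nnegrE // (le_trans M9).
have XA : #|` X|%:R <= 2 ^+ 33 * M2 ^+ 7 * (K * #|` A'|%:R).
  apply: le_trans XK _.
  have -> : (2 ^+ 33 * M2 ^+ 7 * (K * #|` A'|%:R) =
    4 * K * (2 ^+ 31 * M2 ^+ 7 * #|` A'|%:R))%R by ring.
  by rewrite ler_pM2l // mulr_gt0.
have KA : 0 < K * #|` A'|%:R by rewrite mulr_gt0 // (lt_le_trans _ A'1).
have XX2 : #|` diffset2 X X|%:R <= 2 ^+ 138 * M2 ^+ 30 * #|` X|%:R.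
  apply: le_trans XX _; rewrite ler_wpM2r // ler_pM2l // lerXn2r ?nnegrE //; exact: ltW.
apply: (@le_trans _ _ #|` diffset2 (nsum n X) (nsum m X)|%:R).
  by rewrite ler_nat; apply: sumdiff_shift A'X.
suff [D D0 [DC DM]] : exists2 D : R, 0 <= D & D <= C /\
    #|` diffset2 (nsum n X) (nsum m X)|%:R <= D * (M2 ^+ (54 * (n + m)) * (K * #|` A'|%:R)).
  apply: le_trans DM _; rewrite -[X in C * X]mulrA; apply: ler_pM => //.
    by rewrite mulr_ge0 ?exprn_ge0 // ltW.
  by rewrite ler_pM2r.
(* The exponent 54 exceeds the 30 that is needed, so for M2 >= 2 ^ 10 a power of
   M2 absorbs 2 ^ 138; below this threshold nothing does, and growth comes from
   the covering argument. *)
case: (lerP (2 ^+ 10) M2) => M10; last first.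
  exists (C1 * 2 ^+ 103)%R; [exact: ltW | split => //].
  have XX3 : #|` diffset2 X X|%:R <= 2 ^+ 138 * (2 ^+ 10) ^+ 30 * #|` X|%:R :> R.
    apply: le_trans XX2 _; rewrite ler_wpM2r // ler_pM2l // lerXn2r ?nnegrE //; exact: ltW.
  apply: le_trans (grow G X X0 XX3 n m) _.
  have -> : (C1 * 2 ^+ 103 * (M2 ^+ (54 * (n + m)) * (K * #|` A'|%:R)) =
     C1 * M2 ^+ (54 * (n + m)) * (2 ^+ 33 * (2 ^+ 10) ^+ 7 * (K * #|` A'|%:R)))%R.
    by ring.
  apply: ler_pM => //; first by rewrite mulr_ge0 ?exprn_ge0 // ltW.
    (* The base 2 from the covering argument is at most M2. *)
    rewrite ler_pM2l //; apply: (@le_trans _ _ (M2 ^+ (n + m))).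
      by rewrite lerXn2r ?nnegrE // ltW.
    by rewrite ler_weXn2l // leq_pmull.
  apply: le_trans XA _; rewrite ler_pM2r // ler_pM2l // lerXn2r ?nnegrE //; exact: ltW.
exists (2 ^+ 33) => //; first exact: ltW; split=> //.
have nX0 : [fset (- x)%R | x in X] != fset0.
  by rewrite -cardfs_gt0 card_imfset ?cardfs_gt0 //; apply: oppr_inj.
have nXC : #|` [fset (- x)%R | x in X]| = #|` X|.
  by rewrite card_imfset //; apply: oppr_inj.
have pl : #|` diffset2 (nsum n X) (nsum m X)|%:R <=
    (2 ^+ 138 * M2 ^+ 30) ^+ (n + m) * #|` X|%:R :> R.
  by rewrite -nXC; apply: plunnecke => //; rewrite sumsetC -diffset2_sumset nXC.
(* Here 2^138 <= (2^10)^14 <= M2^14, so the base becomes M2^44; the factor M2^7 fits because 44k + 7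
   <= 54k for k >= 1. *)
apply: le_trans pl _; apply: (@le_trans _ _ ((M2 ^+ 44) ^+ (n + m) *
   (2 ^+ 33 * M2 ^+ 7 * (K * #|` A'|%:R)))).
  apply: ler_pM => //; first by rewrite exprn_ge0 // mulr_ge0 ?exprn_ge0.
  rewrite lerXn2r ?nnegrE ?mulr_ge0 ?exprn_ge0 //.
  rewrite (exprD M2 14 30) ler_pM2r ?exprn_gt0 //.
  apply: (@le_trans _ _ ((2 ^+ 10) ^+ 14)); last by rewrite lerXn2r ?nnegrE ?exprn_ge0.
  by rewrite -exprM ler_weXn2l // ler1n.
have ek : (44 * (n + m) + 7 <= 54 * (n + m))%N.
  by rewrite (mulnDl 44 10) leq_add2l (leq_trans _ (leq_pmulr 10 nm0)).
rewrite -exprM -(mulrA (2 ^+ 33)) mulrCA ler_pM2l //.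
by rewrite mulrA ler_pM2r // -exprD ler_weXn2l.
Qed.
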